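(* The equality $\operatorname{ind}A(K/F)=p^{m(K/F)+1}$ does not hold in general: there exist a prime $p$, an integer $n\ge 1$, and a cyclic Galois extension $K/F$ of degree $p^n$ with $\operatorname{char}F\ne p$ and $F$ containing a primitive $p$th root of unity $\xi_p$, with $\operatorname{Gal}(K/F)=\langle\sigma\rangle$, such that $m(K/F)\neq-\infty$ and the cyclic algebra $A(K/F)=(K/F,\sigma,\xi_p)$ satisfies $$\operatorname{ind}A(K/F)<p^{m(K/F)+1}.$$
   Context: Let $p$ be a prime and $K/F$ a cyclic Galois extension of degree $p^n$, $n\ge 1$, with $\operatorname{char}F\ne p$ and $F$ containing a primitive $p$th root of unity $\xi_p$. For $0\le i\le n$ let $K_i$ be the unique intermediate field $F\subseteq K_i\subseteq K$ with $[K_i:F]=p^i$. Define $$m(K/F)=\begin{cases}-\infty, & \xi_p\in N_{K/F}(K^\times),\\ \min\{s\in\{0,\dots,n\} : \xi_p\in N_{K/K_s}(K^\times)\}-1, & \xi_p\notin N_{K/F}(K^\times).\end{cases}$$ For a cyclic extension $L/E$ of degree $r>1$ with $\operatorname{Gal}(L/E)=\langle\tau\rangle$ and $b\in E^\times$, the cyclic algebra $(L/E,\tau,b)$ is the central simple $E$-algebra $\bigoplus_{0\le j<r}u^jL$ with $u^{-1}du=\tau(d)$ for all $d\in L$ and $u^r=b$. If $B$ is a central simple $E$-algebra with $B\simeq M_s(D)$, $D$ a division algebra, its Schur index is $\operatorname{ind}B=\sqrt{\dim_E D}$. *)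

(* Defs.v *)
From HB Require Import structures.
From mathcomp Require Import all_boot all_order all_algebra all_fingroup all_field.
From mathcomp Require Import boolp classical_sets constructive_ereal.
Set Implicit Arguments.
Unset Strict Implicit.
Unset Printing Implicit Defensive.
Import GRing.Theory Num.Theory.
Local Open Scope ring_scope.

Section Norms.
Variables (F : fieldType) (K : splittingFieldType F).

(* a \in N_{K/E}(K^x); [galNorm] is the field norm when K/E is Galois. *)
Definition is_norm_from (E : {subfield K}) (a : F) : Prop :=
  exists2 x : K, x != 0 & galNorm E {:K} x = a%:A.

(* The field K_i; it is unique when K/F is cyclic of degree p ^ n and i <= n
   (every {subfield K} contains F, and \dim is the degree over F). *)
Definition subfield_of_degree (d : nat) : {subfield K} :=
  xget 1%AS [set E : {subfield K} | \dim E = d]%classic.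

(* The minimum is over a nonempty set when [K : F] = p ^ n, since then K_n = K
   and every nonzero element is a norm from K to K_n; this is why the default
   [ord_max] of the arg min is harmless. *)
Definition m_invariant (p n : nat) (xi : F) : \bar int :=
  if `[< is_norm_from 1%AS xi >] then -oo%E
  else ([arg min_(s < ord_max : 'I_n.+1
           | `[< is_norm_from (subfield_of_degree (p ^ s)) xi >]) s]%:Z - 1)%:E.

End Norms.

(* A is the cyclic algebra (L/E, tau, b): with L embedded in A through iota,
   A is the direct sum of the u ^+ j * L for 0 <= j < r = [L : E]. It is meant
   for b != 0 and tau a generator of Gal(L/E); then u is a unit because
   u ^+ r = b. *)
Definition is_cyclic_algebra (E : fieldType) (L : splittingFieldType E)
    (tau : gal_of {:L}) (b : E) (A : falgType E) : Prop :=
  exists (iota : {lrmorphism L -> A}) (u : A),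
    [/\ forall d : L, u^-1 * iota d * u = iota (tau d),
        u ^+ \dim {:L} = b%:A
      & forall a : A, exists! c : {ffun 'I_(\dim {:L}) -> L},
          a = \sum_(j < \dim {:L}) u ^+ j * iota (c j)].

Definition is_division_algebra (E : fieldType) (D : falgType E) : Prop :=
  forall x : D, x != 0 -> x \is a GRing.unit.

(* An isomorphism of E-algebras B ~ M_s(D). The library only scales 'M[D]_s
   by D, so E acts on it through E -> D, k |-> k%:A. *)
Definition is_matrix_algebra_over (E : fieldType) (B D : falgType E) (s : nat)
    : Prop :=
  exists f : {rmorphism B -> 'M[D]_s},
    bijective f /\ (forall (k : E) (x : B), f (k *: x) = k%:A *: f x).

(* The index as a relation rather than a function: asserting it includes the
   existence of the decomposition B ~ M_s(D), so there is no default value;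
   i is unique by Wedderburn's theorem. *)
Definition is_schur_index (E : fieldType) (B : falgType E) (i : nat) : Prop :=
  exists (s : nat) (D : falgType E),
    [/\ is_division_algebra D, is_matrix_algebra_over B D s
      & (i ^ 2)%N = \dim {:D}].

(* Main.v *)
(* The counterexample is p = n = 2, F = rat, K = Q(zeta_5), xi = -1. Complex
   conjugation is the involution of Gal(K/Q), so a norm from K to K_0 or K_1 is
   a product of terms z * conj z >= 0; hence -1 is such a norm from neither
   field and m(K/Q) = 1. On the other hand A(K/Q) has exponent 2, so over a
   number field its index is at most 2: explicitly it is the algebra of 2 x 2
   matrices over the quaternion algebra (-2, -5), which is ramified at 5 and at
   the real place and is a division algebra because its norm form is positive
   definite. *)

Require Import Defs.
From HB Require Import structures.
From mathcomp Require Import all_boot all_order all_algebra all_fingroup all_field.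
From mathcomp Require Import boolp classical_sets constructive_ereal.
From mathcomp Require Import cyclic integral_char ring lra.
Set Implicit Arguments.
Unset Strict Implicit.
Unset Printing Implicit Defensive.
Import Order.TTheory GRing.Theory Num.Theory.
Local Open Scope ring_scope.

(** * Quaternion algebras *)

(** Coordinates in the basis 1, i, j, k = i j with i^2 = a, j^2 = b, j i = - i j. The parameters [a]
    and [b] index the type, so that each pair carries its own product. *)
Definition quaternion (F : fieldType) (a b : F) : Type :=
  (F^o * F^o * F^o * F^o)%type.

Section QuaternionAlgebra.
Variables (F : fieldType) (a b : F).
Local Notation H := (quaternion a b).

HB.instance Definition _ := Vector.on H.

Definition quat1 : H := (1, 0, 0, 0).

Definition quat_mul (x y : H) : H :=
  let: (x0, x1, x2, x3) := x in let: (y0, y1, y2, y3) := y in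
  (x0 * y0 + a * (x1 * y1) + b * (x2 * y2) - a * b * (x3 * y3),
   x0 * y1 + x1 * y0 - b * (x2 * y3) + b * (x3 * y2),
   x0 * y2 + x2 * y0 + a * (x1 * y3) - a * (x3 * y1),
   x0 * y3 + x3 * y0 + x1 * y2 - x2 * y1).

Definition quat_conj (x : H) : H :=
  let: (x0, x1, x2, x3) := x in (x0, - x1, - x2, - x3).

Definition quat_norm (x : H) : F :=
  let: (x0, x1, x2, x3) := x in
  x0 ^+ 2 - a * x1 ^+ 2 - b * x2 ^+ 2 + a * b * x3 ^+ 2.

Lemma quat_addE (x0 x1 x2 x3 y0 y1 y2 y3 : F^o) :
  ((x0, x1, x2, x3) : H) + (y0, y1, y2, y3)
    = (x0 + y0, x1 + y1, x2 + y2, x3 + y3).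
Proof. by []. Qed.

Lemma quat_scaleE (k : F) (x0 x1 x2 x3 : F^o) :
  k *: ((x0, x1, x2, x3) : H)
    = ((k * x0 : F^o), (k * x1 : F^o), (k * x2 : F^o), (k * x3 : F^o)).
Proof. by []. Qed.

Lemma quat_mulA : associative quat_mul.
Proof.
move=> [[[x0 x1] x2] x3] [[[y0 y1] y2] y3] [[[z0 z1] z2] z3] /=.
by congr (_, _, _, _); ring.
Qed.

Lemma quat_mul1q : left_id quat1 quat_mul.
Proof. by move=> [[[x0 x1] x2] x3] /=; congr (_, _, _, _); ring. Qed.

Lemma quat_mulq1 : right_id quat1 quat_mul.
Proof. by move=> [[[x0 x1] x2] x3] /=; congr (_, _, _, _); ring. Qed.

Lemma quat_mulDl : left_distributive quat_mul +%R.
Proof.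
move=> [[[x0 x1] x2] x3] [[[y0 y1] y2] y3] [[[z0 z1] z2] z3].
by rewrite quat_addE /= quat_addE; congr (_, _, _, _); ring.
Qed.

Lemma quat_mulDr : right_distributive quat_mul +%R.
Proof.
move=> [[[x0 x1] x2] x3] [[[y0 y1] y2] y3] [[[z0 z1] z2] z3].
by rewrite quat_addE /= quat_addE; congr (_, _, _, _); ring.
Qed.

Lemma quat1_neq0 : quat1 != 0.
Proof. by apply/eqP=> -[] /eqP; rewrite oner_eq0. Qed.

HB.instance Definition _ := GRing.Zmodule_isNzRing.Build H
  quat_mulA quat_mul1q quat_mulq1 quat_mulDl quat_mulDr quat1_neq0.

Lemma quat_mulE (x0 x1 x2 x3 y0 y1 y2 y3 : F^o) :
  ((x0, x1, x2, x3) : H) * (y0, y1, y2, y3) =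
  ((x0 * y0 + a * (x1 * y1) + b * (x2 * y2) - a * b * (x3 * y3) : F^o),
   (x0 * y1 + x1 * y0 - b * (x2 * y3) + b * (x3 * y2) : F^o),
   (x0 * y2 + x2 * y0 + a * (x1 * y3) - a * (x3 * y1) : F^o),
   (x0 * y3 + x3 * y0 + x1 * y2 - x2 * y1 : F^o)).
Proof. by []. Qed.

Lemma quat_scaleAl (k : F) (x y : H) : k *: (x * y) = (k *: x : H) * y.
Proof.
case: x y => [[[x0 x1] x2] x3] [[[y0 y1] y2] y3].
rewrite quat_mulE !quat_scaleE quat_mulE.
by congr (_, _, _, _); ring.
Qed.

HB.instance Definition _ := GRing.Lmodule_isLalgebra.Build F H quat_scaleAl.

Lemma quat_scaleAr (k : F) (x y : H) : k *: (x * y) = x * (k *: y : H).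
Proof.
case: x y => [[[x0 x1] x2] x3] [[[y0 y1] y2] y3].
rewrite quat_mulE !quat_scaleE quat_mulE.
by congr (_, _, _, _); ring.
Qed.

HB.instance Definition _ := GRing.Lalgebra_isAlgebra.Build F H quat_scaleAr.
HB.instance Definition _ := Algebra_isFalgebra.Build F H.

Lemma dim_quaternion : \dim {:H} = 4%N.
Proof. by rewrite dimvf. Qed.

Lemma quat_mul_conj (x : H) : x * quat_conj x = (quat_norm x)%:A.
Proof.
case: x => [[[x0 x1] x2] x3].
rewrite quat_mulE quat_scaleE /=.
by congr (_, _, _, _); ring.
Qed.

Lemma quat_conj_mul (x : H) : quat_conj x * x = (quat_norm x)%:A.
Proof.
case: x => [[[x0 x1] x2] x3].
rewrite quat_mulE quat_scaleE /=.
by congr (_, _, _, _); ring.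
Qed.

Lemma quaternion_division :
  (forall x : H, quat_norm x = 0 -> x = 0) -> is_division_algebra H.
Proof.
move=> anis x x_neq0; have Nx0 : quat_norm x != 0.
  by apply: contra_neq x_neq0 => /anis.
apply/unitrP; exists ((quat_norm x)^-1 *: quat_conj x).
by rewrite -scalerAl -scalerAr quat_mul_conj quat_conj_mul scalerA
           mulVf ?scale1r.
Qed.

End QuaternionAlgebra.

(** The norm form is a sum of four squares with positive coefficients, so it vanishes only when
    every term does. *)
Lemma quaternion_division_neg (F : realFieldType) (a b : F) :
  a < 0 -> b < 0 -> is_division_algebra (quaternion a b).
Proof.
move=> a_lt0 b_lt0; apply: quaternion_division => -[[[x0 x1] x2] x3] /= Nx0.
have ab_gt0 : 0 < a * b by rewrite nmulr_lgt0.
have h0 : 0 <= x0 ^+ 2 by apply: sqr_ge0.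
have h1 : 0 <= - a * x1 ^+ 2 by rewrite mulr_ge0 ?sqr_ge0 // oppr_ge0 ltW.
have h2 : 0 <= - b * x2 ^+ 2 by rewrite mulr_ge0 ?sqr_ge0 // oppr_ge0 ltW.
have h3 : 0 <= a * b * x3 ^+ 2 by rewrite mulr_ge0 ?sqr_ge0 // ltW.
have sq0 (c x : F) : c != 0 -> c * x ^+ 2 = 0 -> x = 0.
  by move=> c0 /eqP; rewrite mulf_eq0 (negPf c0) sqrf_eq0 => /eqP.
have e0 : x0 = 0 by apply: (sq0 1); rewrite ?oner_eq0 //; lra.
have e1 : x1 = 0 by apply: (sq0 (- a)); rewrite ?oppr_eq0 ?lt_eqF //; lra.
have e2 : x2 = 0 by apply: (sq0 (- b)); rewrite ?oppr_eq0 ?lt_eqF //; lra.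
have e3 : x3 = 0 by apply: (sq0 (a * b)); rewrite ?gt_eqF //; lra.
by rewrite e0 e1 e2 e3.
Qed.

(** * Matrix algebras over a finite-dimensional algebra *)

(* The library scales ['M[D]_n.+1] by [D]; this alias carries the scaling by
   the base field [E]. *)
Definition matrix_algebra (E : fieldType) (D : falgType E) (n : nat) : Type :=
  'M[D]_n.+1.

Section MatrixAlgebra.
Import VectorInternalTheory.
Variables (E : fieldType) (D : falgType E) (n : nat).
Local Notation A := (matrix_algebra D n).

HB.instance Definition _ := GRing.NzRing.on A.

Definition malg_scale (k : E) (M : A) : A := (k%:A : D) *: (M : 'M[D]_n.+1).

Lemma malg_scalerA k l (M : A) :
  malg_scale k (malg_scale l M) = malg_scale (k * l) M.
Proof. by rewrite /malg_scale scalerA -scalerAl mul1r scalerA. Qed.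

Lemma malg_scale1r : left_id 1 malg_scale.
Proof. by move=> M; rewrite /malg_scale !scale1r. Qed.

Lemma malg_scalerDr : right_distributive malg_scale +%R.
Proof. by move=> k M N; apply: scalerDr. Qed.

Lemma malg_scalerDl (M : A) : {morph malg_scale^~ M : k l / k + l}.
Proof. by move=> k l; rewrite /malg_scale scalerDl; apply: scalerDl. Qed.

HB.instance Definition _ := GRing.Zmodule_isLmodule.Build E A
  malg_scalerA malg_scale1r malg_scalerDr malg_scalerDl.

Lemma malg_scaleE (k : E) (M : A) :
  k *: M = (k%:A : D) *: (M : 'M[D]_n.+1).
Proof. by []. Qed.

Lemma malg_scaleAl (k : E) (M N : A) : k *: (M * N) = (k *: M) * N.
Proof. exact: (@scalemxAl D). Qed.

HB.instance Definition _ := GRing.Lmodule_isLalgebra.Build E A malg_scaleAl.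

Lemma malg_scaleAr (k : E) (M N : A) : k *: (M * N) = M * (k *: N).
Proof.
apply/matrixP=> i j; rewrite malg_scaleE !mxE mulr_sumr.
by apply: eq_bigr => l _; rewrite !mxE -!scalerAl !mul1r -scalerAr.
Qed.

HB.instance Definition _ := GRing.Lalgebra_isAlgebra.Build E A malg_scaleAr.

Definition malg_ffun (M : A) : {ffun 'I_n.+1 * 'I_n.+1 -> D} :=
  [ffun ij => (M : 'M[D]_n.+1) ij.1 ij.2].

(** Coordinates over [E] are borrowed from the finite functions on index pairs with values in
    [D]. *)
Lemma malg_vector_axiom : Vector.axiom (#|{: 'I_n.+1 * 'I_n.+1}| * dim D) A.
Proof.
exists (v2r \o malg_ffun) => [k M N|].
  have -> : (v2r \o malg_ffun) (k *: M + N)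
      = v2r (k *: malg_ffun M + malg_ffun N) by
    congr v2r; apply/ffunP=> ij; rewrite !ffunE malg_scaleE !mxE;
    rewrite -scalerAl mul1r.
  by rewrite linearP.
pose malg_mx (f : {ffun 'I_n.+1 * 'I_n.+1 -> D}) : A := \matrix_(i, j) f (i, j).
exists (malg_mx \o r2v) => [M|v] /=.
  by rewrite v2rK; apply/matrixP=> i j; rewrite mxE ffunE.
rewrite -[RHS]r2vK; congr v2r; apply/ffunP=> -[i j].
by rewrite ffunE mxE.
Qed.

HB.instance Definition _ := Lmodule_hasFinDim.Build E A malg_vector_axiom.
HB.instance Definition _ := Algebra_isFalgebra.Build E A.

Lemma dim_matrix_algebra : \dim {:A} = (n.+1 ^ 2 * \dim {:D})%N.
Proof. by rewrite !dimvf /dim /= card_prod card_ord. Qed.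

Lemma is_matrix_algebra_over_matrix_algebra :
  is_matrix_algebra_over A D n.+1.
Proof.
exists (GRing.RMorphism.clone A 'M[D]_n.+1 idfun _).
by split=> //; exists id.
Qed.

End MatrixAlgebra.

(** * Cyclic algebras *)

Section CyclicAlgebraCriterion.
Variables (E : fieldType) (L : splittingFieldType E) (tau : gal_of {:L}).

(** This serves to extract one coefficient of a sum over powers of [tau]. By [gal_matrix] some
    elements [w] have an invertible matrix of conjugates; [e] is the column of its inverse at
    [k0]. *)
Lemma cycle_dual_basis (k0 : 'I_#[tau]%g) :
  exists (m : nat) (w e : 'I_m -> L), forall k : 'I_#[tau]%g,
    \sum_j (tau ^+ k)%g (w j) * e j = (k == k0)%:R.
Proof.
have [w [_ _] [M_unit _ _]] := gal_matrix <[tau]>%g.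
set M := \matrix_(i, j) _ in M_unit.
have tauP k : (tau ^+ k)%g \in <[tau]>%g by rewrite mem_cycle.
pose r k := enum_rank_in (tauP 0) (tau ^+ k)%g.
exists _, (tnth w), (fun j => invmx M j (r k0)) => k.
have := congr1 (fun N : 'M_ _ => N (r k) (r k0)) (mulmxV M_unit).
rewrite !mxE (_ : (r k == r k0) = (k == k0)).
  move<-; apply: eq_bigr => j _; congr (_ * _).
  by rewrite mxE /r enum_rankK_in.
apply/eqP/eqP=> [|-> //].
move/(congr1 enum_val); rewrite !enum_rankK_in //.
move/eqP; rewrite eq_expg_mod_order !modn_small // => /eqP.
exact: val_inj.
Qed.

Variables (A : falgType E) (iota : {lrmorphism L -> A}) (u : A).
Hypothesis iotaM : forall d, iota d * u = u * iota (tau d).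

Lemma cyclic_algebra_comm j d :
  iota d * u ^+ j = u ^+ j * iota ((tau ^+ j)%g d).
Proof.
elim: j d => [|j IHj] d; first by rewrite expg0 gal_id mulr1 mul1r.
by rewrite exprS mulrA iotaM -mulrA IHj mulrA expgS galM ?memvf.
Qed.

(** Multiplying the relation by [iota (w j)] on the left and [iota (e j)] on the right and summing
    over [j] kills every term but the one at [k0]. Then the unit [u ^+ k0] cancels, and [iota] is
    injective on the field [L]. *)
Lemma cyclic_algebra_free (c : 'I_#[tau]%g -> L) :
  u \is a GRing.unit -> \sum_(j < #[tau]%g) u ^+ j * iota (c j) = 0 ->
  forall k, c k = 0.
Proof.
move=> Uu sum0 k0; have [m [w [e we]]] := cycle_dual_basis k0.
apply: (fmorph_inj iota); rewrite rmorph0.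
apply: (mulrI (unitrX k0 Uu)); rewrite mulr0.
transitivity (\sum_j iota (w j) *
    (\sum_(k < #[tau]%g) u ^+ k * iota (c k)) * iota (e j)); last first.
  by rewrite sum0 big1 // => j _; rewrite mulr0 mul0r.
transitivity (\sum_(k < #[tau]%g) u ^+ k *
    iota ((\sum_j (tau ^+ k)%g (w j) * e j) * c k)).
  rewrite (bigD1 k0) //= we eqxx mul1r big1 ?addr0 // => k /negPf nk.
  by rewrite we nk mul0r rmorph0 mulr0.
rewrite [LHS](eq_bigr (fun k : 'I_#[tau]%g =>
  \sum_j iota (w j) * (u ^+ k * iota (c k)) * iota (e j))); last first.
  move=> k _; rewrite mulr_suml rmorph_sum mulr_sumr; apply: eq_bigr => j _.
  rewrite mulrA cyclic_algebra_comm -!mulrA -!rmorphM; congr (_ * iota _).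
  by rewrite [e j * _]mulrC.
rewrite exchange_big; apply: eq_bigr => j _.
by rewrite mulr_sumr mulr_suml.
Qed.

(** The map sending [c] to the sum of the [u ^+ j * iota (c j)] is injective by freeness, and source
    and target both have dimension [L : E]^2, so it is bijective. *)
Lemma cyclic_algebra_criterion (b : E) :
    #[tau]%g = \dim {:L} -> \dim {:A} = (\dim {:L} ^ 2)%N ->
    b != 0 -> u ^+ \dim {:L} = b%:A ->
  is_cyclic_algebra tau b A.
Proof.
move=> o_tau dimA b0 ub.
have Uu : u \is a GRing.unit.
  rewrite -(unitrX_pos _ (adim_gt0 {:L}%AS)) ub.
  by rewrite scaler_unit ?unitr1 // unitfE.
exists iota, u; split=> // [d|a]; first by rewrite -mulrA iotaM mulKr.
pose phi (c : {ffun 'I_(\dim {:L}) -> L}) : A :=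
    \sum_(j < \dim {:L}) u ^+ j * iota (c j).
have phi_lin : linear phi.
  move=> k c c'; rewrite /phi scaler_sumr -big_split; apply: eq_bigr => j _ /=.
  by rewrite !ffunE linearP mulrDr scalerAr.
pose phiL := GRing.isLinear.Build _ _ _ _ phi phi_lin.
pose phiH : {linear _ -> A} := HB.pack phi phiL.
have phi0 c : phi c = 0 -> c = 0.
  move=> c0; apply/ffunP=> j; rewrite ffunE.
  move: (j) c c0; rewrite /phi -o_tau => k c.
  by move/(cyclic_algebra_free Uu); apply.
have phi_inj : injective phiH.
  move=> c c' /eqP; rewrite -subr_eq0 -linearB => /eqP/phi0/eqP.
  by rewrite subr_eq0 => /eqP.
have phiE c : linfun phiH c = phi c by apply: lfunE.
have ker0 : lker (linfun phiH) == 0%VS.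
  by apply/lker0P=> c c'; rewrite !phiE => /phi_inj.
have /memv_imgP[c _] : a \in limg (linfun phiH).
  suff -> : limg (linfun phiH) = fullv by rewrite memvf.
  apply/eqP; rewrite eqEdim subvf /= limg_dim_eq ?(eqP ker0) ?capv0 //.
  rewrite dimA [X in (_ <= X)%N]dimvf.
  rewrite -[X in (_ <= X)%N]/(#|'I_(\dim {:L})| * dim L)%N card_ord.
  by rewrite -[dim L]dimvf mulnn.
rewrite phiE => ->; exists c; split=> // c' /phi_inj; exact.
Qed.

End CyclicAlgebraCriterion.

(** [L] is E[X] modulo [p], so evaluation at a root [W] of [p] factors through it. Each element is
    represented by a chosen polynomial in [w]; two choices differ by a multiple of [p], which
    vanishes at [W]. *)
Lemma lrmorphism_of_generator (E : fieldType) (L : fieldExtType E) (w : L)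
    (A : falgType E) (W : A) (p : {poly E}) :
    <<1; w>>%VS = fullv -> minPoly 1 w = map_poly (in_alg L) p ->
    horner_alg W p = 0 ->
  exists iota : {lrmorphism L -> A}, iota w = W.
Proof.
move=> genL min_w pW.
have /choice[q Dq] x : exists q, x = (map_poly (in_alg L) q).[w].
  by apply/Fadjoin1_polyP; rewrite genL memvf.
have hornerW0 r : (map_poly (in_alg L) r).[w] = 0 -> horner_alg W r = 0.
  move=> rw0; have: minPoly 1 w %| map_poly (in_alg L) r.
    by apply: minPoly_dvdp; [apply: alg_polyOver | apply/rootP].
  rewrite min_w dvdp_map => /dvdpP[s ->].
  by rewrite rmorphM /= pW mulr0.
pose f x := horner_alg W (q x).
(* Independence of the chosen representative; linearity and multiplicativity follow from it. *)
have fE r : f (map_poly (in_alg L) r).[w] = horner_alg W r.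
  apply/eqP; rewrite -subr_eq0 -rmorphB; apply/eqP/hornerW0.
  by rewrite rmorphB hornerD hornerN -Dq subrr.
have f_lin : linear f.
  move=> k x y; transitivity (horner_alg W (k *: q x + q y)).
    rewrite -fE; congr f; rewrite rmorphD /= hornerD -Dq; congr (_ + _).
    by rewrite map_polyZ /= hornerZ /= mulr_algl -Dq.
  by rewrite raddfD /= linearZ /= mulr_algl.
have f_mon : monoid_morphism f.
  split=> [|x y].
    transitivity (horner_alg W 1); last exact: rmorph1.
    by rewrite -fE rmorph1 hornerC.
  by rewrite {1}(Dq x) {1}(Dq y) -hornerM -rmorphM fE rmorphM.
pose fL := GRing.isLinear.Build _ _ _ _ f f_lin.
pose fM := GRing.isMonoidMorphism.Build _ _ f f_mon.
exists (HB.pack f fL fM : {lrmorphism L -> A}) => /=.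
have {1}-> : w = (map_poly (in_alg L) 'X).[w] by rewrite map_polyX hornerX.
by rewrite fE /= horner_algX.
Qed.

(** * The fifth cyclotomic field *)

Lemma root_sum_expX (F : fieldType) n (x : F) :
  x ^+ n = 1 -> x != 1 -> root (\sum_(i < n) 'X^i) x.
Proof.
move=> xn1 x_neq1; apply/rootP.
rewrite horner_sum (eq_bigr (fun i : 'I_n => x ^+ i)); last first.
  by move=> i _; rewrite hornerXn.
apply/eqP; have := subrX1 x n; rewrite xn1 subrr => /esym/eqP.
by rewrite mulf_eq0 subr_eq0 (negPf x_neq1).
Qed.

Lemma sum_expX_poly (F : fieldType) n :
  \sum_(i < n.+1) 'X^i = \poly_(i < n.+1) 1 :> {poly F}.
Proof. by rewrite poly_def; apply: eq_bigr => i _; rewrite scale1r. Qed.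

(** The minimal polynomial divides 1 + X + ... + X^(p-1). It is also a multiple of the rational
    minimal polynomial of the image of [w] in [algC], which is cyclotomic of degree p - 1, so the
    sizes agree. *)
Lemma minPoly_prime_root (p : nat) (K : fieldExtType rat)
    (QnC : {rmorphism K -> algC}) (w : K) :
    prime p -> p.-primitive_root w ->
  minPoly 1 w = map_poly (in_alg K) (\sum_(i < p) 'X^i).
Proof.
move=> pr_p prim_w; have p_gt1 := prime_gt1 pr_p.
have w_neq1 : w != 1 by rewrite -[w]expr1 -(prim_order_dvd prim_w) gtnNdvd.
rewrite rmorph_sum /= (eq_bigr (fun i : 'I_p => 'X^i)); last first.
  by move=> i _; rewrite map_polyXn.
set Phi := \sum_(i < p) _.
have PhiE : Phi = \poly_(i < p) 1.
  by rewrite /Phi -(prednK (prime_gt0 pr_p)) sum_expX_poly.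
have sz_Phi : size Phi = p.
  by rewrite PhiE size_poly_eq ?oner_eq0.
have mon_Phi : Phi \is monic.
  by rewrite monicE lead_coefE sz_Phi PhiE coef_poly ltn_predL prime_gt0.
have dvd_Phi : minPoly 1 w %| Phi.
  apply: minPoly_dvdp.
    by rewrite rpred_sum // => i _; rewrite rpredX ?polyOverX.
  by apply: root_sum_expX; first exact: prim_expr_order.
apply/eqP; rewrite -eqp_monic ?monic_minPoly //.
rewrite -dvdp_size_eqp // eqn_leq dvdp_leq ?monic_neq0 //=.
have /polyOver1P[q Dq] := minPolyOver 1 w.
have prim_z : p.-primitive_root (QnC w) by rewrite fmorph_primitive_root.
have [r [Dr mon_r] dv_r] := minCpolyP (QnC w).
have Dq' : map_poly QnC (minPoly 1 w) = map_poly ratr q.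
  rewrite Dq -map_poly_comp; apply: eq_map_poly => b /=.
  by rewrite alg_num_field fmorph_rat.
have r_dv_q : r %| q by rewrite -dv_r -Dq' fmorph_root root_minPoly.
have q_neq0 : q != 0.
  by rewrite -(map_poly_eq0 (in_alg K)) -Dq monic_neq0 ?monic_minPoly.
rewrite sz_Phi Dq size_map_poly (leq_trans _ (dvdp_leq q_neq0 r_dv_q)) //.
rewrite -(size_map_poly (ratr : {rmorphism rat -> algC})) -Dr.
rewrite (minCpoly_cyclotomic prim_z) size_cyclotomic totient_prime //.
by rewrite prednK ?prime_gt0.
Qed.

(** Since 2 generates the units modulo 5, the automorphism squaring [w] generates the Galois
    group. *)
Lemma cyclotomic5_field :
  exists (K : splittingFieldType rat) (QnC : {rmorphism K -> algC}) (w : K)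
      (sigma : gal_of {:K}),
    [/\ galois 1 {:K}, \dim {:K} = 4%N, #[sigma]%g = 4%N,
        'Gal({:K} / 1)%g = <[sigma]>%g :> {set _}
      & <<1; w>>%VS = fullv] /\
    [/\ 5.-primitive_root w, sigma w = w ^+ 2
      & minPoly 1 w = map_poly (in_alg K) (\sum_(i < 5) 'X^i)].
Proof.
(* The order 5 of this group becomes the order of the root of unity [w] generating the field. *)
have [K galK [QnC _ [w [prim_w gen_w] _]]] :=
  group_num_field_exists [set: 'I_5]%G.
rewrite cardsT card_ord in prim_w.
have min_w := minPoly_prime_root QnC (isT : prime 5) prim_w.
have w_roots k : (0 < k < 5)%N -> root (minPoly 1 w) (w ^+ k).
  move=> /andP[k_gt0 k_lt5].
  rewrite min_w rmorph_sum /= (eq_bigr (fun i : 'I_5 => 'X^i)); last first.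
    by move=> i _; rewrite map_polyXn.
  apply: root_sum_expX; first by rewrite exprAC (prim_expr_order prim_w) expr1n.
  by rewrite -(prim_order_dvd prim_w) gtnNdvd.
have dimK : \dim {:K} = 4%N.
  rewrite -gen_w dim_Fadjoin dimv1 muln1; apply: succn_inj.
  rewrite -size_minPoly min_w size_map_poly sum_expX_poly.
  by rewrite size_poly_eq ?oner_eq0.
have [sigma galS sw] := normalField_root_minPoly (sub1v {:K}%AS)
  (normalFieldf 1) (memvf w) (w_roots 2%N isT).
have oG : #|'Gal({:K} / 1)%g| = 4%N.
  by rewrite -(galois_dim galK) dimK dimv1 divn1.
have oS : #[sigma]%g = 4%N.
  have: (#[sigma]%g %| 4)%N by rewrite -oG order_dvdG.
  (* The square of [sigma] sends [w] to [w ^+ 4], which differs from [w]. *)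
  have: ~~ (#[sigma]%g %| 2)%N.
    rewrite order_dvdn; apply/eqP=> /(congr1 (fun g : gal_of {:K} => g w)).
    rewrite gal_id expgS expg1 galM ?memvf //= sw rmorphXn /= sw -exprM.
    move/eqP; rewrite -{2}[w]expr1 (eq_prim_root_expr prim_w) //.
  by case: #[sigma]%g => [|[|[|[|[|n]]]]].
exists K, QnC, w, sigma; split; split=> //.
by apply/eqP; rewrite eq_sym eqEcard cycle_subG galS oG -orderE oS.
Qed.

(** Every element is a rational polynomial in [w], and both sides fix the rational coefficients, so
    agreement at [w] suffices. *)
Lemma conj_of_generator (K : splittingFieldType rat)
    (QnC : {rmorphism K -> algC}) (w : K) (c : gal_of {:K}) :
    <<1; w>>%VS = fullv -> QnC (c w) = (QnC w)^* ->
  forall x, QnC (c x) = (QnC x)^*.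
Proof.
move=> gen_w cw x.
have /Fadjoin1_polyP[q ->] : x \in <<1; w>>%VS by rewrite gen_w memvf.
set P := map_poly _ q.
have cP : map_poly c P = P.
  rewrite /P -map_poly_comp; apply: eq_map_poly => b /=.
  by rewrite linearZ /= rmorph1.
have conjP : map_poly Num.conj (map_poly QnC P) = map_poly QnC P.
  rewrite /P -!map_poly_comp; apply: eq_map_poly => b /=.
  by rewrite alg_num_field !fmorph_rat.
rewrite -(horner_map c) /= cP -(horner_map QnC) /= cw.
by rewrite -[in RHS](horner_map QnC) -[in RHS](horner_map Num.conj) /= conjP.
Qed.

(** * Norms from the intermediate fields and the value of m *)

Lemma dim_subfield_of_degree (F : fieldType) (L : splittingFieldType F)
    (E : {subfield L}) (d : nat) :
  \dim E = d -> \dim (subfield_of_degree L d) = d.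
Proof.
move=> dimE; pose S := [set E : {subfield L} | \dim E = d]%classic.
by apply: (@xgetPex _ 1%AS S); exists E.
Qed.

(** The default of [xget] is the base field, of dimension 1, so the bound holds whether or not a
    subfield of degree [d] has been exhibited. This is enough to exclude s = 0 and s = 1 below. *)
Lemma dim_subfield_of_degree_leq (F : fieldType) (L : splittingFieldType F)
    (d : nat) :
  (0 < d)%N -> (\dim (subfield_of_degree L d) <= d)%N.
Proof.
move=> d_gt0; rewrite /subfield_of_degree; case: xgetP => [E _ /= -> //|_].
by rewrite dimv1.
Qed.

Lemma is_norm_from_full (F : fieldType) (L : splittingFieldType F)
    (E : {subfield L}) (a : F) :
  \dim E = \dim {:L} -> a != 0 -> is_norm_from E a.
Proof.
move=> dimE a0; exists a%:A; first by rewrite scaler_eq0 oner_eq0 orbF.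
have -> : E = {:L}%AS by apply/val_inj/eqP; rewrite eqEdim subvf dimE leqnn.
rewrite /galNorm (bigD1 1%g) //= gal_id big1 ?mulr1 // => g /andP[Gg].
case/eqP; apply/eqP/gal_eqP=> x _; rewrite gal_id.
by apply: fixed_gal Gg _; rewrite ?subvf ?memvf.
Qed.

Section NotNorm.
Variables (K : splittingFieldType rat) (QnC : {rmorphism K -> algC}).
Variable (sigma : gal_of {:K}).
Hypothesis galK : galois 1 {:K}.
Hypothesis o_sigma : #[sigma]%g = 4%N.
Hypothesis gen_sigma : 'Gal({:K} / 1)%g = <[sigma]>%g :> {set _}.
Hypothesis conjE : forall x, QnC ((sigma ^+ 2)%g x) = (QnC x)^*.

(** A cyclic group of order 4 has a single involution, which lies in every nontrivial subgroup. *)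
Lemma mem_sigma2 (G : {group gal_of {:K}}) :
  G \subset <[sigma]>%g -> (1 < #|G|)%N -> (sigma ^+ 2)%g \in G.
Proof.
move=> sGS; rewrite cardG_gt1 => /trivgPn[g Gg].
have /cyclePmin[k] := fintype.subsetP sGS g Gg; rewrite o_sigma => k_lt4 Dg.
have := groupX 2 Gg; move: Gg; rewrite {}Dg -expgM.
case: k k_lt4 => [|[|[|[|k]]]] // _ Gs Gs2; rewrite ?expg0 ?eqxx // => _.
move: Gs2; rewrite -[(3 * 2)%N]/(4 + 2)%N expgnDr -{1}o_sigma.
by rewrite expg_order mul1g.
Qed.

(** Complex conjugation [sigma ^+ 2] lies in the Galois group of K over the proper subfield [E]. The
    factors of the norm then pair up into products y * conj y, so its image in [algC] is
    nonnegative. *)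
Lemma galNorm_neq_opp1 (E : {subfield K}) (x : K) :
  (\dim E < 4)%N -> galNorm E {:K} x != -1.
Proof.
move=> dimE.
have galE : galois E {:K} by rewrite (galoisS _ galK) ?sub1v ?subvf.
have sE : 'Gal({:K} / E)%g \subset <[sigma]>%g.
  by rewrite -gen_sigma galS ?sub1v.
have oG : (#|'Gal({:K} / E)%g| * \dim E)%N = 4%N.
  rewrite -(galois_dim galE) divnK ?field_dimS ?subvf //.
  by have := galois_dim galK; rewrite gen_sigma -orderE o_sigma dimv1 divn1.
have sigma2 : (sigma ^+ 2)%g \in 'Gal({:K} / E)%g.
  apply: mem_sigma2 sE _; rewrite ltnNge; apply: contraL dimE => oG1.
  by rewrite -leqNgt -oG -[X in (_ <= X)%N]mul1n leq_mul2r oG1 orbT.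
have pair_ge0 y : 0 <= QnC (y * (sigma ^+ 2)%g y).
  by rewrite rmorphM /= conjE mul_conjC_ge0.
suff: 0 <= QnC (galNorm E {:K} x).
  by apply: contraTneq => ->; rewrite rmorphN1 oppr_ge0 (lt_geF ltr01).
have expg_eq i j : (i < 4)%N -> (j < 4)%N ->
    (sigma ^+ i == sigma ^+ j)%g = (i == j).
  by move=> i4 j4; rewrite eq_expg_mod_order o_sigma !modn_small.
rewrite /galNorm (bigD1 1%g) //= (bigD1 (sigma ^+ 2)%g) /=; last first.
  by rewrite sigma2 (expg_eq 2%N 0%N).
rewrite gal_id mulrA rmorphM mulr_ge0 //=.
(* The group is either everything, with pairs {1, sigma^2} and {sigma, sigma^3}, or just {1,
   sigma^2}. *)
have [sigma1|nsigma1] := boolP (sigma \in 'Gal({:K} / E)%g).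
  rewrite (bigD1 sigma) /=; last first.
    by rewrite sigma1 (expg_eq 1%N 0%N) // (expg_eq 1%N 2%N).
  rewrite (bigD1 (sigma ^+ 3)%g) /=; last first.
    rewrite groupX // (expg_eq 3%N 0%N) // (expg_eq 3%N 2%N) //.
    by rewrite (expg_eq 3%N 1%N).
  rewrite big1 ?mulr1; last first.
    move=> g /andP[/andP[/andP[/andP[Gg g0] g2] g1] g3].
    have /cyclePmin[k] := fintype.subsetP sE g Gg; rewrite o_sigma => k_lt4 Dg.
    by move: g0 g1 g2 g3; rewrite Dg; case: k k_lt4 {Dg} => [|[|[|[|k]]]] //;
       rewrite ?expg0 ?expg1 ?eqxx.
  by rewrite (expgS sigma 2) galM ?memvf.
rewrite big1 ?rmorph1 ?ler01 // => g /andP[/andP[Gg g0] g2].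
have /cyclePmin[k] := fintype.subsetP sE g Gg; rewrite o_sigma => k_lt4 Dg.
case/negP: nsigma1; move: Gg g0 g2; rewrite Dg.
case: k k_lt4 {Dg} => [|[|[|[|k]]]] //; rewrite ?expg0 ?expg1 ?eqxx //.
(* Membership of sigma^3 = sigma * sigma^2 would force that of sigma. *)
by move=> _ Gs3 _ _; rewrite -(groupMr _ sigma2) -expgS.
Qed.

Lemma not_norm_opp1 (E : {subfield K}) :
  (\dim E < 4)%N -> ~ is_norm_from E (-1).
Proof.
move=> dimE [x _] /eqP; rewrite scaleN1r.
exact/negP/galNorm_neq_opp1.
Qed.

Lemma m_invariant_opp1 : m_invariant K 2 2 (-1) = 1%:E.
Proof.
have dimK : \dim {:K} = 4%N.
  by have := galois_dim galK; rewrite gen_sigma -orderE o_sigma dimv1 divn1.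
rewrite /m_invariant; case: asboolP => [N1|_].
  by case: (@not_norm_opp1 1%AS); rewrite ?dimv1.
case: arg_minnP => [|s /asboolP s_norm _].
  (* The default [ord_max] is s = 2, where K_2 = K and -1 is its own norm. *)
  apply/asboolP; apply: is_norm_from_full; last by rewrite oppr_eq0 oner_eq0.
  by rewrite dimK; apply: dim_subfield_of_degree dimK.
(* For s = 2 the value is 2 - 1 = 1; for s = 0 and s = 1 the dimension of K_s is at most 2^s < 4. *)
case: s s_norm => -[|[|[|//]]] lt_s3 //= s_norm; case: (not_norm_opp1 _ s_norm).
  exact: leq_ltn_trans (dim_subfield_of_degree_leq _ _) _.
exact: leq_ltn_trans (dim_subfield_of_degree_leq _ _) _.
Qed.
End NotNorm.

(** * An explicit splitting *)

Definition mx2 (R : nzRingType) (a b c d : R) : 'M[R]_2 :=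
  \matrix_(i, j) if i == 0 then if j == 0 then a else b
                 else if j == 0 then c else d.

Lemma mx2M (R : nzRingType) (a b c d a' b' c' d' : R) :
  mx2 a b c d *m mx2 a' b' c' d' =
  mx2 (a * a' + b * c') (a * b' + b * d') (c * a' + d * c') (c * b' + d * d').
Proof.
apply/matrixP=> i j; rewrite !mxE !big_ord_recl big_ord0 !mxE /= addr0.
by case: ifP; case: ifP.
Qed.

Lemma mx2D (R : nzRingType) (a b c d a' b' c' d' : R) :
  mx2 a b c d + mx2 a' b' c' d' = mx2 (a + a') (b + b') (c + c') (d + d').
Proof. by apply/matrixP=> i j; rewrite !mxE; case: ifP; case: ifP. Qed.

Lemma mx2_1 (R : nzRingType) : 1%:M = mx2 1 0 0 1 :> 'M[R]_2.
Proof.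
by apply/matrixP=> -[[|[|]] //= ?] [[|[|]] //= ?]; rewrite !mxE.
Qed.

Definition quat_2_5 : falgType rat := quaternion (-2 : rat) (-5).
Definition matrix_quat : falgType rat := matrix_algebra quat_2_5 1.
Definition q4 (x0 x1 x2 x3 : rat) : quat_2_5 := (x0, x1, x2, x3).

(* With R = [[0, 5], [1, 0]] in the role of sqrt 5 and i^2 = -2, j^2 = -5,
   k = i j, the element s = ((3 + R) i + (1 - R / 5) k) / 4 satisfies
   s^2 = - (5 + R) / 2, like zeta_5 - zeta_5^-1; hence the image
   (R - 1) / 4 + s / 2 of zeta_5. *)
Definition zeta_mx : matrix_quat :=
  mx2 (q4 (- (1/4)) (3/8) 0 (1/8)) (q4 (5/4) (5/8) 0 (- (1/8)))
      (q4 (1/4) (1/8) 0 (- (1/40))) (q4 (- (1/4)) (3/8) 0 (1/8)).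

(* A solution of the linear system zeta_mx * u = u * zeta_mx ^+ 2, which
   determines u up to right multiplication by the image of K. *)
Definition u_mx : matrix_quat :=
  mx2 (q4 0 (1/2) 0 0) (q4 0 0 0 (1/2))
      (q4 0 0 0 (- (1/10))) (q4 0 (- (1/2)) 0 0).

Lemma u_mx2 : u_mx ^+ 2 = mx2 0 (q4 0 0 (-1) 0) (q4 0 0 (- (1/5)) 0) 0.
Proof.
rewrite expr2 [LHS]mx2M; congr mx2; apply/eqP; vm_compute; reflexivity.
Qed.

(** The boolean form lets [vm_compute] decide identities between explicit rational entries. *)
Lemma mx2_eq (R : nzRingType) (a b c d a' b' c' d' : R) :
  [&& a == a', b == b', c == c' & d == d'] -> mx2 a b c d = mx2 a' b' c' d'.
Proof. by case/and4P=> /eqP-> /eqP-> /eqP-> /eqP->. Qed.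

Lemma mx2N (R : nzRingType) (a b c d : R) :
  - mx2 a b c d = mx2 (- a) (- b) (- c) (- d).
Proof. by apply/matrixP=> i j; rewrite !mxE; case: ifP; case: ifP. Qed.

Lemma mx2_0 (R : nzRingType) : 0 = mx2 0 0 0 0 :> 'M[R]_2.
Proof. by apply/matrixP=> i j; rewrite !mxE !if_same. Qed.

(** By [u_mx2], u^2 = - j R / 5 with R = [[0, 5], [1, 0]]. As j commutes with R, j^2 = -5 and R^2 =
    5, the fourth power is -25 / 25 = -1. *)
Lemma u_mx4 : u_mx ^+ 4 = (-1)%:A.
Proof.
rewrite (exprM _ 2 2) u_mx2 scaleN1r expr2 [LHS]mx2M.
rewrite (mx2_1 quat_2_5 : 1 = _ :> matrix_quat) [RHS]mx2N.
by apply: mx2_eq; vm_compute.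
Qed.

(** The relation d u = u sigma(d) for d = zeta_5, which sigma squares. *)
Lemma zeta_mx_u : zeta_mx * u_mx = u_mx * zeta_mx ^+ 2.
Proof.
rewrite expr2 mulrA [LHS]mx2M [u_mx * _]mx2M [RHS]mx2M.
by apply: mx2_eq; vm_compute.
Qed.

Lemma zeta_mx_root : horner_alg zeta_mx (\sum_(i < 5) 'X^i) = 0.
Proof.
rewrite rmorph_sum /= (eq_bigr (fun i : 'I_5 => zeta_mx ^+ i)); last first.
  by move=> i _; rewrite rmorphXn /= horner_algX.
(* Horner's scheme, so that each step is one product and one sum of explicit 2 x 2 matrices. *)
have -> : \sum_(i < 5) zeta_mx ^+ i
    = 1 + zeta_mx * (1 + zeta_mx * (1 + zeta_mx * (1 + zeta_mx))).
  rewrite !big_ord_recl big_ord0 addr0 /= !mulrDr !mulr1 expr0 expr1.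
  by rewrite /bump /= !exprS expr0 mulr1.
rewrite (mx2_1 quat_2_5 : 1 = _ :> matrix_quat).
rewrite (mx2_0 quat_2_5 : 0 = _ :> matrix_quat).
rewrite [mx2 _ _ _ _ + zeta_mx]mx2D.
do 2![rewrite [zeta_mx * mx2 _ _ _ _]mx2M [mx2 _ _ _ _ + mx2 _ _ _ _]mx2D].
rewrite [zeta_mx * mx2 _ _ _ _]mx2M [LHS]mx2D.
by apply: mx2_eq; vm_compute.
Qed.

(** The elements [d] satisfying the relation are closed under sums and products and contain the
    scalars, so it is enough that [w] is among them. *)
Lemma cyclic_relation_of_generator (E : fieldType) (L : splittingFieldType E)
    (tau : gal_of {:L}) (w : L) (A : falgType E) (iota : {lrmorphism L -> A})
    (u : A) :
    <<1; w>>%VS = fullv -> iota w * u = u * iota (tau w) ->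
  forall d, iota d * u = u * iota (tau d).
Proof.
move=> gen_w uw d.
have /Fadjoin1_polyP[q ->] : d \in <<1; w>>%VS by rewrite gen_w memvf.
elim/poly_ind: q => [|q c IHq].
  by rewrite rmorph0 horner0 !rmorph0 mul0r mulr0.
rewrite rmorphD rmorphM /= map_polyX map_polyC /= hornerD hornerMX hornerC.
rewrite !rmorphD !rmorphM /= mulrDl mulrDr -mulrA uw !mulrA IHq; congr (_ + _).
by rewrite !linearZ /= !rmorph1 mulr_algl mulr_algr.
Qed.

Lemma primitive_root_opp1 : 2.-primitive_root (-1 : rat).
Proof.
apply/andP; split=> //; apply/forallP=> -[[|[|//]] lt_i2] /=.
  by rewrite unity_rootE expr1.
by rewrite unity_rootE sqrrN expr1n eqxx.
Qed.

Theorem mainTheorem4 :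
  exists (p n : nat) (F : fieldType) (K : splittingFieldType F)
         (xi : F) (sigma : gal_of {:K}),
    [/\ prime p, (1 <= n)%N, p \notin [pchar F] & p.-primitive_root xi] /\
    [/\ galois 1%VS {:K}, \dim {:K} = (p ^ n)%N
      & 'Gal({:K} / 1%VS)%g = <[sigma]>%g :> {set gal_of {:K}}] /\
    m_invariant K p n xi != -oo%E /\
    exists (A : falgType F) (i : nat),
      [/\ is_cyclic_algebra sigma xi A, is_schur_index A i
        & i%:Q < p%:Q ^ (fine (m_invariant K p n xi) + 1)].
Proof.
have [K [QnC [w [sigma [[galK dimK o_sigma genG gen_w] [prim_w sw min_w]]]]]] :=
  cyclotomic5_field.
(* The square of [sigma] sends [w] to w^4 = w^-1, and the inverse of a complex number of modulus 1
   is its conjugate. *)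
have conjE : forall x, QnC ((sigma ^+ 2)%g x) = (QnC x)^*.
  apply: (conj_of_generator gen_w).
  have prim_z : 5.-primitive_root (QnC w) by rewrite fmorph_primitive_root.
  rewrite expgS expg1 galM ?memvf // sw rmorphXn /= sw -exprM rmorphXn /=.
  have z0 : QnC w != 0.
    apply/eqP=> z0.
    by move/eqP: (prim_expr_order prim_z); rewrite z0 expr0n eq_sym oner_eq0.
  have norm_z : `|QnC w| = 1.
    apply/eqP; rewrite -(@pexpr_eq1 _ _ 5) ?normr_ge0 // -normrX.
    by rewrite (prim_expr_order prim_z) normr1.
  apply: (mulfI z0); rewrite -exprS (prim_expr_order prim_z).
  by rewrite -normCK norm_z expr1n.
have m1 := m_invariant_opp1 galK o_sigma genG conjE.
exists 2%N, 2%N, rat, K, (-1), sigma; rewrite m1.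
split; first by split; rewrite ?primitive_root_opp1 ?pchar_num.
split=> //; split=> //.
(* The index is 2, because the quaternion algebra has dimension 4 = 2^2, while the bound is 2^(1 +
   1) = 4. *)
exists matrix_quat, 2%N; split=> //.
  have [iota iota_w] := lrmorphism_of_generator gen_w min_w zeta_mx_root.
  apply: (@cyclic_algebra_criterion _ _ _ _ iota u_mx).
  - apply: (cyclic_relation_of_generator gen_w).
    by rewrite sw rmorphXn /= iota_w zeta_mx_u.
  - by rewrite dimK.
  - by rewrite dimK dim_matrix_algebra dim_quaternion.
  - by rewrite oppr_eq0 oner_eq0.
  - by rewrite dimK u_mx4.
exists 2%N, quat_2_5; split.
- exact: quaternion_division_neg.
- exact: is_matrix_algebra_over_matrix_algebra.
- by rewrite dim_quaternion.
Qed.
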